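(* Let $N\ge 2$ be an integer, and let $K_N(x,y,z)=\sum_{j,k}\binom{j+k}{k}^N\frac{x^jy^k}{z^{j+k}}$ (sum over $j,k\ge 0$). Put $$W(x,y,z)=z-\prod_{j=1}^{N-1}(1+Y_j)\left(x+\frac{y}{Y_1Y_2\cdots Y_{N-1}}\right)\in\mathbb{Z}[x,y,z,Y_1^{\pm1},\dots,Y_{N-1}^{\pm1}].$$ Then the kernel $K_N(x,y,z)$ has the following representation as an $(N-1)$-fold integral: $$K_N(x,y,z)=\frac{1}{(2\pi i)^{N-1}}\oint_T\frac{1}{W(x/z,y/z,1)}\prod_{j=1}^{N-1}\frac{dY_j}{Y_j}.$$
   Context: $T$ is the torus defined by $|Y_j|=\epsilon_j$, $j=1,\dots,N-1$. The function $K_N$ is the multiplication kernel for the $N$-Bessel function $\Phi_N(x)=\sum_{i\ge0}x^i/(i!)^N$, i.e. the generating function of the $N$-th powers of the binomial coefficients; it depends only on $x/z$ and $y/z$.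
   Formalization: The English gives no domain for x, y, z, and for arbitrary values the identity fails (the series diverges or poles cross T); it is stated for complex x, y, z with ∏(1+ε_j)(|x|+|y|/∏ε_j) < |z|, where 1/W expands as a geometric series on T. *)

(* Defs.v *)
From Stdlib Require Import Reals List.
From Coquelicot Require Import Coquelicot.
Import ListNotations.
Open Scope C_scope.

Definition Cprod (l : list C) : C := fold_right Cmult 1 l.
Definition Rprod (l : list R) : R := fold_right Rmult 1%R l.

(* Unordered sum over (j, k) in nat * nat: absolute convergence, and [s] is
   the limit of the rectangular partial sums. *)
Definition is_double_series (a : nat -> nat -> C) (s : C) : Prop :=
  (exists M : R, forall m n : nat,
     (sum_n (fun j => sum_n (fun k => Cmod (a j k)) n) m <= M)%R) /\
  filterlim (fun p : nat * nat => sum_n (fun j => sum_n (a j) (snd p)) (fst p))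
    (filter_prod eventually eventually) (locally s).

Definition ex_double_series (a : nat -> nat -> C) : Prop :=
  exists s : C, is_double_series a s.

(* Meaningful only under [ex_double_series a]. *)
Definition double_series (a : nat -> nat -> C) : C :=
  iota (T := C_R_CompleteNormedModule) (is_double_series a).

(* [Binomial.C n k : R] is the binomial coefficient; the unqualified [C] is
   the type of complex numbers. *)
Definition K_term (N : nat) (x y z : C) (j k : nat) : C :=
  RtoC (Binomial.C (j + k) k) ^ N * (x ^ j * y ^ k / z ^ (j + k)).

Definition K (N : nat) (x y z : C) : C := double_series (K_term N x y z).

(* [Y] lists Y_1, ..., Y_{N-1}. *)
Definition W (x y z : C) (Y : list C) : C :=
  z - Cprod (map (fun Yj => 1 + Yj) Y) * (x + y / Cprod Y).

Definition on_torus (eps : list R) (Y : list C) : Prop :=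
  Forall2 (fun Yj e => Cmod Yj = e) Y eps.

(* r e^{it} *)
Definition circle (r t : R) : C := (r * cos t, r * sin t)%R.

(* The integral of f(Y) dY over |Y| = r, counterclockwise; on the circle
   Y = r e^{it} one has dY = i Y dt. *)
Definition circle_integrand (r : R) (f : C -> C) (t : R) : C :=
  f (circle r t) * (Ci * circle r t).

Definition ex_circle_int (r : R) (f : C -> C) : Prop :=
  ex_RInt (V := C_R_NormedModule) (circle_integrand r f) 0%R (2 * PI)%R.

Definition circle_int (r : R) (f : C -> C) : C :=
  RInt (V := C_R_CompleteNormedModule) (circle_integrand r f) 0%R (2 * PI)%R.

(* The iterated integral of f(Y_1, ..., Y_m) dY_1 ... dY_m over the torus
   |Y_j| = eps_j, with Y_1 outermost. *)
Fixpoint torus_int (eps : list R) (f : list C -> C) : C :=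
  match eps with
  | [] => f []
  | e :: eps' => circle_int e (fun Y1 => torus_int eps' (fun Y => f (Y1 :: Y)))
  end.

Fixpoint ex_torus_int (eps : list R) (f : list C -> C) : Prop :=
  match eps with
  | [] => True
  | e :: eps' =>
      (forall Y1 : C, Cmod Y1 = e -> ex_torus_int eps' (fun Y => f (Y1 :: Y))) /\
      ex_circle_int e (fun Y1 => torus_int eps' (fun Y => f (Y1 :: Y)))
  end.

(* The coefficient of dY_1 ... dY_{N-1} in
   1 / W(x/z, y/z, 1) * prod_j dY_j / Y_j. *)
Definition K_integrand (x y z : C) (Y : list C) : C :=
  / W (x / z) (y / z) 1 Y * Cprod (map Cinv Y).

(* Main.v *)
(* On the torus put P = prod (1 + Y_j), u = P x/z and v = P y/(z prod Y_j), so that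
   W(x/z, y/z, 1) = 1 - u - v with |u| + |v| bounded away from 1. The rectangular
   partial sums of sum C(j+k, k) u^j v^k converge to 1/(1 - u - v) uniformly on
   the torus, hence may be integrated term by term. Each term is a product of
   functions of the single Y_j, and the integral of (1+Y)^(j+k) Y^(-k) dY/Y over a
   circle is 2 pi i C(j+k, k), because both sides obey Pascal's rule; this yields
   N - 1 further binomial factors. Absolute convergence of the kernel comes from
   C(j+k, k) e^k <= (1+e)^(j+k), used with e = eps_j for each of the N - 1 extra
   factors. *)
Require Import Defs.
From Stdlib Require Import Reals List Lia Lra.
From Coquelicot Require Import Coquelicot.
Import ListNotations.
Open Scope C_scope.

(** * Binomial coefficients indexed by their two lower parts *)

Definition pascal_coeff (j k : nat) : R := Binomial.C (j + k) k.

Lemma pascal_coeff_0_l (k : nat) : pascal_coeff 0 k = 1%R.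
Proof.
  unfold pascal_coeff, Binomial.C; simpl.
  rewrite Nat.sub_diag; simpl.
  field; apply INR_fact_neq_0.
Qed.

Lemma pascal_coeff_0_r (j : nat) : pascal_coeff j 0 = 1%R.
Proof.
  unfold pascal_coeff, Binomial.C.
  rewrite Nat.add_0_r, Nat.sub_0_r; simpl.
  field; apply INR_fact_neq_0.
Qed.

Lemma pascal_coeff_S (j k : nat) :
  pascal_coeff (S j) (S k) = (pascal_coeff j (S k) + pascal_coeff (S j) k)%R.
Proof.
  unfold pascal_coeff.
  replace (S j + S k)%nat with (S (j + S k)) by lia.
  rewrite <- pascal by lia.
  replace (S j + k)%nat with (j + S k)%nat by lia; ring.
Qed.

Lemma pascal_coeff_sym (j k : nat) : pascal_coeff j k = pascal_coeff k j.
Proof.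
  unfold pascal_coeff.
  rewrite (Nat.add_comm k j), pascal_step1 by lia.
  f_equal; lia.
Qed.

Lemma pascal_coeff_pos (j k : nat) : (0 < pascal_coeff j k)%R.
Proof.
  unfold pascal_coeff, Binomial.C.
  apply Rdiv_lt_0_compat; [|apply Rmult_lt_0_compat]; apply INR_fact_lt_0.
Qed.

(** The left-hand side is a single term of the binomial expansion of the right-hand side. The double
    induction applies Pascal's rule to both sides. *)
Lemma pascal_coeff_bound (e : R) (j k : nat) : (0 <= e)%R ->
  (pascal_coeff j k * e ^ k <= (1 + e) ^ (j + k))%R.
Proof.
  intros He; revert k; induction j as [|j IHj]; intros k.
  - rewrite pascal_coeff_0_l, Rmult_1_l; apply pow_incr; lra.
  - induction k as [|k IHk].
    + rewrite pascal_coeff_0_r, Rmult_1_l; apply pow_R1_Rle; lra.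
    + rewrite pascal_coeff_S.
      specialize (IHj (S k)).
      replace (S j + k)%nat with (j + S k)%nat in IHk by lia.
      replace (S j + S k)%nat with (S (j + S k)) by lia.
      simpl pow in *; nra.
Qed.

(* [sum_n_ext] leaves an equation in a canonical-structure carrier, which [ring]
   does not recognize. *)
Ltac ring_C := match goal with |- ?a = ?b => change (@eq C a b); ring end.
Ltac ring_R := match goal with |- ?a = ?b => change (@eq R a b); ring end.

(** * Finite sums over the real and complex numbers *)

Lemma sum_n_C_Sn (a : nat -> C) (n : nat) : sum_n a (S n) = sum_n a n + a (S n).
Proof. exact (sum_Sn a n). Qed.

Lemma sum_n_R_Sn (a : nat -> R) (n : nat) : sum_n a (S n) = (sum_n a n + a (S n))%R.
Proof. exact (sum_Sn a n). Qed.

Lemma sum_n_Cmult_l (c : C) (a : nat -> C) (n : nat) :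
  sum_n (fun k => c * a k) n = c * sum_n a n.
Proof. exact (sum_n_mult_l (K := C_Ring) c a n). Qed.

Lemma sum_n_Rmult_l (c : R) (a : nat -> R) (n : nat) :
  sum_n (fun k => c * a k)%R n = (c * sum_n a n)%R.
Proof. exact (sum_n_mult_l (K := R_Ring) c a n). Qed.

Lemma sum_n_Rle (a b : nat -> R) (n : nat) :
  (forall k, a k <= b k)%R -> (sum_n a n <= sum_n b n)%R.
Proof.
  intros H; induction n as [|n IH].
  - rewrite !sum_O; apply H.
  - rewrite !sum_n_R_Sn; apply Rplus_le_compat; auto.
Qed.

Lemma Cmod_sum_n (a : nat -> C) (n : nat) :
  (Cmod (sum_n a n) <= sum_n (fun k => Cmod (a k)) n)%R.
Proof.
  induction n as [|n IH].
  - rewrite !sum_O; apply Rle_refl.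
  - rewrite sum_n_C_Sn, sum_n_R_Sn.
    eapply Rle_trans; [apply Cmod_triangle|]; lra.
Qed.

Lemma Cmod_pow (c : C) (n : nat) : Cmod (c ^ n) = (Cmod c ^ n)%R.
Proof.
  induction n as [|n IH]; simpl.
  - apply Cmod_1.
  - now rewrite Cmod_mult, IH.
Qed.

(** * Truncations of the binomial series and of its double series *)

(** Truncation of the power series of (1 - v)^-(m+1). *)
Definition pascal_row (v : C) (m n : nat) : C :=
  sum_n (fun k => RtoC (pascal_coeff m k) * v ^ k) n.

Lemma pascal_row_0 (v : C) (n : nat) :
  (1 - v) * pascal_row v 0 n = 1 - v ^ S n.
Proof.
  unfold pascal_row; induction n as [|n IH].
  - rewrite sum_O, pascal_coeff_0_l; simpl; ring.
  - rewrite sum_n_C_Sn, Cmult_plus_distr_l, IH, pascal_coeff_0_l.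
    simpl; ring.
Qed.

(** Pascal's rule makes the product telescope, and only the term at the truncation order is left
    over. *)
Lemma pascal_row_S (v : C) (m n : nat) :
  (1 - v) * pascal_row v (S m) n
  = pascal_row v m n - RtoC (pascal_coeff (S m) n) * v ^ S n.
Proof.
  unfold pascal_row; induction n as [|n IH].
  - rewrite !sum_O, !pascal_coeff_0_r; simpl; ring.
  - rewrite !sum_n_C_Sn, Cmult_plus_distr_l, IH, pascal_coeff_S, RtoC_plus.
    simpl; ring.
Qed.

Definition pascal_rect (u v : C) (m n : nat) : C :=
  sum_n (fun j => sum_n (fun k =>
    RtoC (pascal_coeff j k) * (u ^ j * v ^ k)) n) m.

Lemma pascal_rect_rows (u v : C) (m n : nat) :
  pascal_rect u v m n = sum_n (fun j => u ^ j * pascal_row v j n) m.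
Proof.
  apply sum_n_ext; intros j; unfold pascal_row.
  rewrite <- sum_n_Cmult_l; apply sum_n_ext; intros k; ring_C.
Qed.

(* Multiplying by [1 - u - v] telescopes, by Pascal's rule, everything but the
   boundary of the rectangle. *)
Lemma pascal_rect_eq (u v : C) (m n : nat) :
  (1 - (u + v)) * pascal_rect u v m n
  = 1 - u ^ S m * pascal_row v m n - v ^ S n * pascal_row u n m.
Proof.
  rewrite pascal_rect_rows; induction m as [|m IH].
  - assert (Hrow : pascal_row u n 0 = 1)
      by (unfold pascal_row; rewrite sum_O, pascal_coeff_0_r; simpl; ring_C).
    rewrite sum_O, Hrow.
    transitivity ((1 - v) * pascal_row v 0 n - u * pascal_row v 0 n);
      [simpl; ring|].
    rewrite pascal_row_0; simpl; ring.
  - rewrite sum_n_C_Sn, Cmult_plus_distr_l, IH.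
    assert (Hrow : pascal_row u n (S m)
        = pascal_row u n m + RtoC (pascal_coeff (S m) n) * u ^ S m).
    { unfold pascal_row; now rewrite sum_n_C_Sn, (pascal_coeff_sym n (S m)). }
    rewrite Hrow.
    (* The new row is split so that it appears multiplied by 1 - v, where [pascal_row_S] applies. *)
    transitivity (1 - u ^ S m * pascal_row v m n - v ^ S n * pascal_row u n m
      + (u ^ S m * ((1 - v) * pascal_row v (S m) n)
         - u ^ S (S m) * pascal_row v (S m) n)); [simpl; ring|].
    rewrite pascal_row_S; simpl; ring.
Qed.

(** Carries the complex row identities over to real arguments, where signs turn them into bounds. *)
Lemma pascal_row_R (V : R) (m n : nat) :
  pascal_row V m n = RtoC (sum_n (fun k => pascal_coeff m k * V ^ k)%R n).
Proof.
  unfold pascal_row; induction n as [|n IH].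
  - rewrite !sum_O, RtoC_mult, RtoC_pow; reflexivity.
  - rewrite sum_n_C_Sn, sum_n_R_Sn, RtoC_plus, IH, RtoC_mult, RtoC_pow.
    reflexivity.
Qed.

(** The bound is the sum of the full series, whose terms are nonnegative. In the induction, the
    boundary term of each row identity is dropped. *)
Lemma pascal_row_R_bound (V : R) (m n : nat) : (0 <= V < 1)%R ->
  (sum_n (fun k => pascal_coeff m k * V ^ k)%R n <= (/ (1 - V)) ^ S m)%R.
Proof.
  intros HV.
  assert (Hpos : (0 < / (1 - V))%R) by (apply Rinv_0_lt_compat; lra).
  assert (Hn : (0 <= V ^ S n)%R) by (apply pow_le; lra).
  induction m as [|m IH].
  - pose proof (pascal_row_0 V n) as H.
    rewrite pascal_row_R, <- RtoC_pow, <- !RtoC_minus, <- RtoC_mult in H.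
    apply RtoC_inj in H.
    simpl pow at 2; rewrite Rmult_1_r.
    apply Rmult_le_reg_l with (1 - V)%R; [lra|].
    rewrite H, Rinv_r; lra.
  - pose proof (pascal_row_S V m n) as H.
    rewrite !pascal_row_R, <- RtoC_pow, <- !RtoC_mult, <- !RtoC_minus,
      <- RtoC_mult in H.
    apply RtoC_inj in H.
    pose proof (pascal_coeff_pos (S m) n).
    apply Rmult_le_reg_l with (1 - V)%R; [lra|].
    rewrite H; change ((/ (1 - V)) ^ S (S m))%R
      with (/ (1 - V) * (/ (1 - V)) ^ S m)%R.
    rewrite <- Rmult_assoc, Rinv_r by lra; nra.
Qed.

Lemma Cmod_pascal_row (v : C) (V : R) (m n : nat) : (Cmod v <= V < 1)%R ->
  (Cmod (pascal_row v m n) <= (/ (1 - V)) ^ S m)%R.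
Proof.
  intros [Hv HV].
  pose proof (Cmod_ge_0 v).
  eapply Rle_trans; [apply Cmod_sum_n|].
  eapply Rle_trans; [|apply (pascal_row_R_bound V m n); lra].
  apply sum_n_Rle; intros k.
  pose proof (pascal_coeff_pos m k).
  rewrite Cmod_mult, Cmod_R, Rabs_pos_eq, Cmod_pow by lra.
  apply Rmult_le_compat_l; [lra|]; apply pow_incr; lra.
Qed.

Lemma geom_sum_bound (q : R) (n : nat) : (0 <= q < 1)%R ->
  (sum_n (fun j => q ^ j)%R n <= / (1 - q))%R.
Proof.
  intros Hq.
  eapply Rle_trans; [|eapply Rle_trans; [apply (pascal_row_R_bound q 0 n Hq)|]].
  - apply sum_n_Rle; intros k; rewrite pascal_coeff_0_l; lra.
  - simpl; lra.
Qed.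

(** Bounding each row by its full sum leaves 1/(1 - V) times a geometric series of ratio U/(1 - V),
    with total 1/(1 - U - V). *)
Lemma pascal_rect_R_bound (U V : R) (m n : nat) :
  (0 <= U)%R -> (0 <= V)%R -> (U + V < 1)%R ->
  (sum_n (fun j => sum_n (fun k => pascal_coeff j k * (U ^ j * V ^ k))%R n) m
   <= / (1 - (U + V)))%R.
Proof.
  intros HU HV Huv.
  assert (Hi : (0 < / (1 - V))%R) by (apply Rinv_0_lt_compat; lra).
  assert (Hr : (0 <= U * / (1 - V) < 1)%R).
  { split; [apply Rmult_le_pos; lra|].
    apply Rmult_lt_reg_r with (1 - V)%R; [lra|].
    rewrite Rmult_assoc, Rinv_l; lra. }
  apply Rle_trans with (/ (1 - V) * sum_n (fun j => (U * / (1 - V)) ^ j)%R m)%R.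
  - rewrite <- sum_n_Rmult_l; apply sum_n_Rle; intros j.
    apply Rle_trans with (U ^ j * (/ (1 - V)) ^ S j)%R.
    + rewrite (sum_n_ext _ (fun k => U ^ j * (pascal_coeff j k * V ^ k))%R)
        by (intros; ring_R).
      rewrite sum_n_Rmult_l; apply Rmult_le_compat_l; [now apply pow_le|].
      apply pascal_row_R_bound; lra.
    + rewrite Rpow_mult_distr; simpl; lra.
  - eapply Rle_trans.
    + apply Rmult_le_compat_l; [lra|]; apply geom_sum_bound, Hr.
    + right; field; lra.
Qed.

(** Dividing [pascal_rect_eq] by 1 - u - v leaves the two boundary terms as the error. The bound
    involves only U and V, so it is uniform in u and v; both ratios are below 1 because U + V <
    1. *)
Lemma Cmod_pascal_rect_sub (u v : C) (U V : R) (m n : nat) :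
  (Cmod u <= U)%R -> (Cmod v <= V)%R -> (U + V < 1)%R ->
  (Cmod (pascal_rect u v m n - / (1 - (u + v)))
   <= ((U * / (1 - V)) ^ S m + (V * / (1 - U)) ^ S n) * / (1 - (U + V)))%R.
Proof.
  intros Hu Hv Huv.
  pose proof (Cmod_ge_0 u); pose proof (Cmod_ge_0 v).
  assert (Hd : (1 - (U + V) <= Cmod (1 - (u + v)))%R).
  { pose proof (Cmod_triangle (1 - (u + v)) (u + v)) as T.
    replace (1 - (u + v) + (u + v)) with (RtoC 1) in T by ring.
    rewrite Cmod_1 in T; pose proof (Cmod_triangle u v); lra. }
  assert (Hnz : 1 - (u + v) <> 0) by (apply Cmod_gt_0; lra).
  assert (E : pascal_rect u v m n - / (1 - (u + v))
    = - (u ^ S m * pascal_row v m n + v ^ S n * pascal_row u n m)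
      * / (1 - (u + v))).
  { transitivity (((1 - (u + v)) * pascal_rect u v m n - 1) * / (1 - (u + v)));
      [field; exact Hnz|].
    rewrite pascal_rect_eq; f_equal; ring. }
  rewrite E, Cmod_mult, Cmod_opp, Cmod_inv by exact Hnz.
  assert (Hterm : forall (a b : C) (A B : R) (p q : nat), (Cmod a <= A)%R ->
    (Cmod b <= B)%R -> (B < 1)%R ->
    (Cmod (a ^ S p * pascal_row b p q) <= (A * / (1 - B)) ^ S p)%R).
  { intros a b A B p q Ha Hb HB.
    rewrite Cmod_mult, Cmod_pow, Rpow_mult_distr.
    apply Rmult_le_compat; [apply pow_le, Cmod_ge_0|apply Cmod_ge_0| |].
    - apply pow_incr; split; [apply Cmod_ge_0|exact Ha].
    - apply Cmod_pascal_row; lra. }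
  apply Rmult_le_compat.
  - apply Cmod_ge_0.
  - apply Rlt_le, Rinv_0_lt_compat; lra.
  - eapply Rle_trans; [apply Cmod_triangle|].
    apply Rplus_le_compat; apply Hterm; lra.
  - apply Rinv_le_contravar; lra.
Qed.

(** * Polar form of points on a circle *)

Lemma Rprod_pos (l : list R) : List.Forall (fun e => (0 < e)%R) l -> (0 < Rprod l)%R.
Proof.
  unfold Rprod; induction 1; simpl; [lra|]; now apply Rmult_lt_0_compat.
Qed.

Lemma Cmod_circle (r t : R) : (0 <= r)%R -> Cmod (circle r t) = r.
Proof.
  intros Hr; unfold Cmod, circle; simpl fst; simpl snd.
  replace ((r * cos t) ^ 2 + (r * sin t) ^ 2)%R
    with (r ^ 2 * ((sin t)² + (cos t)²))%R by (unfold Rsqr; ring).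
  rewrite sin2_cos2, Rmult_1_r; now apply sqrt_pow2.
Qed.

Lemma Cmod_Ci : Cmod Ci = 1%R.
Proof.
  unfold Cmod, Ci; simpl.
  replace (0 * (0 * 1) + 1 * (1 * 1))%R with 1%R by ring; apply sqrt_1.
Qed.

Lemma circle_neq_0 (r t : R) : (0 < r)%R -> circle r t <> 0.
Proof. intros Hr; apply Cmod_gt_0; rewrite Cmod_circle; lra. Qed.

Lemma circle_mult (r s t u : R) :
  circle r t * circle s u = circle (r * s) (t + u).
Proof.
  unfold circle, Cmult; simpl; rewrite cos_plus, sin_plus; f_equal; ring.
Qed.

Lemma circle_pow (r t : R) (n : nat) : circle r t ^ n = circle (r ^ n) (INR n * t).
Proof.
  induction n as [|n IH].
  - unfold circle; simpl; rewrite Rmult_0_l, cos_0, sin_0.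
    apply injective_projections; simpl; ring.
  - simpl Cpow; rewrite IH, circle_mult, S_INR; f_equal; ring.
Qed.

Lemma Cinv_circle (r t : R) : (0 < r)%R -> / circle r t = circle (/ r) (- t).
Proof.
  intros Hr; pose proof (circle_neq_0 r t Hr) as Hnz.
  assert (H : circle r t * circle (/ r) (- t) = 1).
  { rewrite circle_mult, Rinv_r, Rplus_opp_r by lra.
    unfold circle; rewrite cos_0, sin_0.
    apply injective_projections; simpl; ring. }
  transitivity (/ circle r t * (circle r t * circle (/ r) (- t)));
    [rewrite H; ring | now field].
Qed.

(** * Integrals over a single circle *)

Definition is_RInt_C (f : R -> C) (a b : R) (I : C) : Prop :=
  is_RInt (V := C_R_NormedModule) f a b I.

Lemma is_RInt_C_ext (f g : R -> C) (a b : R) (I J : C) :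
  (forall t, f t = g t) -> I = J -> is_RInt_C f a b I -> is_RInt_C g a b J.
Proof. intros H <-; apply is_RInt_ext; intros t _; apply H. Qed.

Lemma is_RInt_C_plus (f g : R -> C) (a b : R) (I J : C) :
  is_RInt_C f a b I -> is_RInt_C g a b J ->
  is_RInt_C (fun t => f t + g t) a b (I + J).
Proof. exact (is_RInt_plus f g a b I J). Qed.

(** The module structure in use is over the reals, so a complex factor is treated through real and
    imaginary parts. *)
Lemma is_RInt_C_mult_l (c : C) (f : R -> C) (a b : R) (I : C) :
  is_RInt_C f a b I -> is_RInt_C (fun t => c * f t) a b (c * I).
Proof.
  intros H.
  pose proof (is_RInt_fct_extend_fst f a b I H) as H1.
  pose proof (is_RInt_fct_extend_snd f a b I H) as H2.
  apply is_RInt_fct_extend_pair.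
  - apply (is_RInt_minus (V := R_NormedModule)
      (fun t => fst c * fst (f t))%R (fun t => snd c * snd (f t))%R);
      now apply (is_RInt_scal (V := R_NormedModule)).
  - apply (is_RInt_plus (V := R_NormedModule)
      (fun t => fst c * snd (f t))%R (fun t => snd c * fst (f t))%R);
      now apply (is_RInt_scal (V := R_NormedModule)).
Qed.

(** For a nonzero integer frequency the primitives r/w sin(wt) and -r/w cos(wt) agree at both ends
    of the period. The two signs of w serve positive and negative powers of Y. *)
Lemma is_RInt_circle_0 (r w : R) (n : nat) :
  (w = INR (S n) \/ w = - INR (S n))%R ->
  is_RInt_C (fun t => circle r (w * t)) 0 (2 * PI) 0.
Proof.
  intros Hw.
  assert (Hpos : (0 < INR (S n))%R) by apply lt_0_INR, Nat.lt_0_succ.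
  assert (Hs : sin (w * (2 * PI)) = 0%R /\ cos (w * (2 * PI)) = 1%R).
  { pose proof (sin_period 0 (S n)) as S0; pose proof (cos_period 0 (S n)) as C0.
    rewrite Rplus_0_l, sin_0 in S0; rewrite Rplus_0_l, cos_0 in C0.
    destruct Hw as [-> | ->].
    - replace (INR (S n) * (2 * PI))%R with (2 * INR (S n) * PI)%R by ring.
      now split.
    - replace (- INR (S n) * (2 * PI))%R with (- (2 * INR (S n) * PI))%R by ring.
      rewrite sin_neg, cos_neg, S0, C0; split; ring. }
  assert (Hw0 : w <> 0%R) by (destruct Hw; lra).
  destruct Hs as [Hsin Hcos].
  apply is_RInt_fct_extend_pair; simpl.
  - assert (E : minus (r / w * sin (w * (2 * PI)))%R (r / w * sin (w * 0))%R = 0%R)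
      by (rewrite Hsin, !Rmult_0_r, sin_0; unfold minus, plus, opp; simpl; ring).
    rewrite <- E at 2; apply (is_RInt_derive (V := R_CompleteNormedModule)
      (fun t => r / w * sin (w * t))%R (fun t => r * cos (w * t))%R).
    + intros t _; auto_derive; [exact I | now field].
    + intros t _; apply (ex_derive_continuous (fun t => r * cos (w * t))%R).
      auto_derive; exact I.
  - assert (E : minus (- r / w * cos (w * (2 * PI)))%R (- r / w * cos (w * 0))%R = 0%R)
      by (rewrite Hcos, !Rmult_0_r, cos_0; unfold minus, plus, opp; simpl; ring).
    rewrite <- E at 2; apply (is_RInt_derive (V := R_CompleteNormedModule)
      (fun t => - r / w * cos (w * t))%R (fun t => r * sin (w * t))%R).
    + intros t _; auto_derive; [exact I | now field].
    + intros t _; apply (ex_derive_continuous (fun t => r * sin (w * t))%R).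
      auto_derive; exact I.
Qed.

(** The expansion of the integrand contains only positive powers of w. It is used with w the point
    on the circle and with w its inverse. *)
Lemma is_RInt_pow_binomial_0 (w : R -> C) (a b : R) :
  (forall m, is_RInt_C (fun t => w t ^ S m) a b 0) ->
  forall j m, is_RInt_C (fun t => (1 + w t) ^ j * w t ^ S m) a b 0.
Proof.
  intros H j; induction j as [|j IH]; intros m.
  - refine (is_RInt_C_ext _ _ _ _ _ _ _ eq_refl (H m)); intros t; simpl; ring.
  - refine (is_RInt_C_ext _ _ _ _ _ _ _ _
      (is_RInt_C_plus _ _ _ _ _ _ (IH m) (IH (S m)))); [|ring].
    intros t; simpl; ring.
Qed.

(** The integral extracts the constant term of the Laurent polynomial (1+Y)^(j+k) Y^(-k). The
    induction follows Pascal's rule, with the edges j = 0 and k = 0 treated apart. *)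
Lemma is_RInt_binomial (e : R) (j k : nat) : (0 < e)%R ->
  is_RInt_C (fun t => (1 + circle e t) ^ (j + k) * / circle e t ^ k)
    0 (2 * PI) (RtoC (2 * PI * pascal_coeff j k)).
Proof.
  intros He.
  assert (Hc := fun t => circle_neq_0 e t He).
  assert (Hpos := is_RInt_pow_binomial_0 (circle e) 0 (2 * PI)
    (fun m => is_RInt_C_ext _ _ _ _ _ _
      (fun t => eq_sym (circle_pow e t (S m))) eq_refl
      (is_RInt_circle_0 (e ^ S m) _ m (or_introl eq_refl)))).
  assert (Hneg : forall i m, is_RInt_C
    (fun t => (1 + / circle e t) ^ i * (/ circle e t) ^ S m) 0 (2 * PI) 0).
  { apply (is_RInt_pow_binomial_0 (fun t => / circle e t)); intros m.
    refine (is_RInt_C_ext _ _ _ _ _ _ _ eq_refl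
      (is_RInt_circle_0 ((/ e) ^ S m) _ m (or_intror eq_refl))).
    intros t; rewrite Cinv_circle, circle_pow by exact He; f_equal; ring. }
  revert k; induction j as [|j IHj]; intros k.
  - induction k as [|k IHk].
    + rewrite pascal_coeff_0_l.
      pose proof (is_RInt_const (V := C_R_NormedModule) 0 (2 * PI) (RtoC 1)) as H.
      refine (is_RInt_C_ext _ _ _ _ _ _ _ _ H).
      * intros t; simpl; field; exact C1_nz.
      * apply injective_projections; simpl; unfold scal; simpl;
          unfold mult; simpl; ring.
    + rewrite pascal_coeff_0_l in IHk |- *.
      (* (1 + 1/Y)^(k+1) = (1 + 1/Y)^k + (1 + 1/Y)^k / Y, and the last term has only negative
         powers. *)
      refine (is_RInt_C_ext _ _ _ _ _ _ _ _
        (is_RInt_C_plus _ _ _ _ _ _ IHk (Hneg k 0%nat))); [|ring].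
      intros t; specialize (Hc t).
      replace (1 + / circle e t) with ((1 + circle e t) * / circle e t)
        by (field; exact Hc).
      rewrite Cpow_mult_l, Cpow_inv by exact Hc.
      pose proof (Cpow_nz _ k Hc); simpl; field; auto.
  - induction k as [|k IHk].
    + specialize (IHj 0%nat); rewrite pascal_coeff_0_r in IHj |- *.
      (* (1+Y)^(j+1) = (1+Y)^j + (1+Y)^j Y, and the last term has only positive powers. *)
      refine (is_RInt_C_ext _ _ _ _ _ _ _ _
        (is_RInt_C_plus _ _ _ _ _ _ IHj (Hpos j 0%nat))); [|ring].
      intros t; rewrite !Nat.add_0_r; simpl; field; exact C1_nz.
    + rewrite pascal_coeff_S.
      (* One factor 1 + Y of the integrand is expanded, which is Pascal's rule for the constant
         terms. *)
      refine (is_RInt_C_ext _ _ _ _ _ _ _ _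
        (is_RInt_C_plus _ _ _ _ _ _ (IHj (S k)) IHk));
        [|rewrite <- RtoC_plus; f_equal; ring].
      intros t; specialize (Hc t); pose proof (Cpow_nz _ k Hc).
      replace (S j + k)%nat with (j + S k)%nat by lia.
      change (S j + S k)%nat with (S (j + S k)).
      simpl; field; auto.
Qed.

(** * Iterated integrals over the torus *)

(** Existence at every level travels with the value, since [torus_int] is informative only when the
    integrals exist. *)
Definition is_torus_int (eps : list R) (f : list C -> C) (I : C) : Prop :=
  ex_torus_int eps f /\ torus_int eps f = I.

(** The inner integral has to be known only on the circle itself, which is where [circle_integrand]
    evaluates it. *)
Lemma is_torus_int_cons (e : R) (eps : list R) (f : list C -> C) (g : C -> C)
  (I : C) : (0 < e)%R ->
  (forall Y1, Cmod Y1 = e -> is_torus_int eps (fun Y => f (Y1 :: Y)) (g Y1)) ->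
  is_RInt_C (circle_integrand e g) 0 (2 * PI) I ->
  is_torus_int (e :: eps) f I.
Proof.
  intros He Hf Hg.
  assert (H : is_RInt_C (circle_integrand e
    (fun Y1 => torus_int eps (fun Y => f (Y1 :: Y)))) 0 (2 * PI) I).
  { refine (is_RInt_C_ext _ _ _ _ _ _ _ eq_refl Hg); intros t.
    unfold circle_integrand; f_equal; symmetry; apply Hf.
    apply Cmod_circle; lra. }
  split; [split|].
  - intros Y1 HY; apply (Hf Y1 HY).
  - exists I; exact H.
  - exact (is_RInt_unique (V := C_R_CompleteNormedModule) _ _ _ _ H).
Qed.

Lemma is_torus_int_cons_inv (e : R) (eps : list R) (f : list C -> C) (I : C) :
  is_torus_int (e :: eps) f I ->
  (forall Y1, Cmod Y1 = e -> is_torus_int eps (fun Y => f (Y1 :: Y))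
     (torus_int eps (fun Y => f (Y1 :: Y)))) /\
  is_RInt_C (circle_integrand e
    (fun Y1 => torus_int eps (fun Y => f (Y1 :: Y)))) 0 (2 * PI) I.
Proof.
  intros [[H1 H2] <-]; split.
  - intros Y1 HY; split; auto.
  - exact (RInt_correct (V := C_R_CompleteNormedModule) _ _ _ H2).
Qed.

Lemma is_torus_int_ext (eps : list R) (f g : list C -> C) (I : C) :
  List.Forall (fun e => (0 < e)%R) eps ->
  (forall Y, on_torus eps Y -> f Y = g Y) ->
  is_torus_int eps f I -> is_torus_int eps g I.
Proof.
  intros Heps; revert f g I; induction Heps as [|e eps He _ IH]; intros f g I Hfg HI.
  - destruct HI as [_ <-]; split; [exact Logic.I|].
    symmetry; apply Hfg; constructor.
  - apply is_torus_int_cons_inv in HI; destruct HI as [H1 H2].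
    refine (is_torus_int_cons _ _ _ _ _ He _ H2).
    intros Y1 HY; apply (IH _ _ _ (fun Y h => Hfg _ (Forall2_cons _ _ HY h)) (H1 Y1 HY)).
Qed.

Lemma is_torus_int_lin (eps : list R) (c : C) (f g : list C -> C) (I J : C) :
  List.Forall (fun e => (0 < e)%R) eps ->
  is_torus_int eps f I -> is_torus_int eps g J ->
  is_torus_int eps (fun Y => f Y + c * g Y) (I + c * J).
Proof.
  intros Heps; revert f g I J.
  induction Heps as [|e eps He _ IH]; intros f g I J HI HJ.
  - destruct HI as [_ <-]; destruct HJ as [_ <-]; now split.
  - apply is_torus_int_cons_inv in HI; destruct HI as [HI1 HI2].
    apply is_torus_int_cons_inv in HJ; destruct HJ as [HJ1 HJ2].
    refine (is_torus_int_cons _ _ _ _ _ He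
      (fun Y1 HY => IH _ _ _ _ (HI1 Y1 HY) (HJ1 Y1 HY)) _).
    refine (is_RInt_C_ext _ _ _ _ _ _ _ eq_refl
      (is_RInt_C_plus _ _ _ _ _ _ HI2 (is_RInt_C_mult_l c _ _ _ _ HJ2))).
    intros t; unfold circle_integrand; ring.
Qed.

Lemma is_torus_int_sum_n (eps : list R) (f : nat -> list C -> C) (I : nat -> C)
  (n : nat) : List.Forall (fun e => (0 < e)%R) eps ->
  (forall k, is_torus_int eps (f k) (I k)) ->
  is_torus_int eps (fun Y => sum_n (fun k => f k Y) n) (sum_n I n).
Proof.
  intros Heps H; induction n as [|n IH].
  - rewrite sum_O; refine (is_torus_int_ext _ _ _ _ Heps _ (H 0%nat)).
    intros Y _; now rewrite sum_O.
  - rewrite sum_n_C_Sn, <- (Cmult_1_l (I (S n))).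
    refine (is_torus_int_ext _ _ _ _ Heps _
      (is_torus_int_lin _ 1 _ _ _ _ Heps IH (H (S n)))).
    intros Y _; rewrite sum_n_C_Sn; ring.
Qed.

(** The constant c is general so that it can absorb the factors of the outer variables, which are
    fixed during the inner integrals. *)
Lemma is_torus_int_prod (eps : list R) (h : C -> C) (c I : C) :
  List.Forall (fun e => (0 < e)%R /\ is_RInt_C (circle_integrand e h) 0 (2 * PI) I) eps ->
  is_torus_int eps (fun Y => c * Cprod (map h Y)) (c * I ^ length eps).
Proof.
  intros Heps; revert c; induction Heps as [|e eps [He HI] Heps IH]; intros c.
  - now split.
  - refine (is_torus_int_cons _ _ _ (fun Y1 => c * h Y1 * I ^ length eps) _ He _ _).
    + intros Y1 _.
      refine (is_torus_int_ext _ _ _ _ _ _ (IH (c * h Y1))).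
      * revert Heps; apply Forall_impl; now intros a [Ha _].
      * intros Y _; unfold Cprod; simpl; ring.
    + refine (is_RInt_C_ext _ _ _ _ _ _ _ _
        (is_RInt_C_mult_l (c * I ^ length eps) _ _ _ _ HI)).
      * intros t; unfold circle_integrand; ring.
      * simpl; ring.
Qed.

(** The standard estimate by the length 2 pi e of each circle times the supremum of the
    integrand. *)
Lemma is_torus_int_bound (eps : list R) (f : list C -> C) (I : C) (d : R) :
  List.Forall (fun e => (0 < e)%R) eps -> is_torus_int eps f I ->
  (forall Y, on_torus eps Y -> (Cmod (f Y) <= d)%R) ->
  (Cmod I <= Rprod (map (fun e => 2 * PI * e)%R eps) * d)%R.
Proof.
  intros Heps; revert f I d.
  induction Heps as [|e eps He _ IH]; intros f I d HI Hd.
  - destruct HI as [_ <-]; unfold Rprod; simpl; rewrite Rmult_1_l.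
    apply Hd; constructor.
  - apply is_torus_int_cons_inv in HI; destruct HI as [H1 H2].
    pose proof PI_RGT_0.
    set (M := Rprod (map (fun e => 2 * PI * e)%R eps)).
    replace (Rprod (map (fun e => 2 * PI * e)%R (e :: eps)) * d)%R
      with ((2 * PI - 0) * (M * d * e))%R by (unfold M, Rprod; simpl; ring).
    rewrite Cmod_norm.
    refine (norm_RInt_le_const (V := C_R_NormedModule) _ _ _ _ _ _ _ H2); [lra|].
    intros t _; rewrite <- Cmod_norm; unfold circle_integrand.
    assert (HC : Cmod (circle e t) = e) by (apply Cmod_circle; lra).
    rewrite !Cmod_mult, HC, Cmod_Ci, Rmult_1_l.
    apply Rmult_le_compat_r; [lra|].
    apply (IH _ _ _ (H1 _ HC)).
    intros Y HY; apply Hd; now constructor.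
Qed.

(** Balls of the product uniform structure on the complex plane are squares, and each contains the
    disc of the same radius. *)
Lemma filterlim_C {U : Type} (F : (U -> Prop) -> Prop) {FF : Filter F}
  (f : U -> C) (l : C) :
  (forall d : posreal, F (fun p => (Cmod (f p - l) < d)%R)) ->
  filterlim f F (locally l).
Proof.
  intros H; apply filterlim_locally; intros d.
  generalize (H d); apply filter_imp; intros p Hp.
  apply (norm_compat1 (V := C_R_NormedModule)); rewrite <- Cmod_norm; exact Hp.
Qed.

(** Induction on the number of circles: uniform closeness on the torus passes to the inner integrals
    by [is_torus_int_bound], and the outer circle is then an ordinary uniform limit. Integrability
    of the limit comes out together with its value. *)
Lemma is_torus_int_uniform_limit {U : Type} (F : (U -> Prop) -> Prop)
  {FF : ProperFilter F} (eps : list R) (f : U -> list C -> C) (h : U -> C)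
  (g : list C -> C) :
  List.Forall (fun e => (0 < e)%R) eps ->
  (forall p, is_torus_int eps (f p) (h p)) ->
  (forall d : posreal,
     F (fun p => forall Y, on_torus eps Y -> (Cmod (f p Y - g Y) < d)%R)) ->
  exists I, is_torus_int eps g I /\ filterlim h F (locally I).
Proof.
  intros Heps; revert f h g.
  induction Heps as [|e eps He Heps IH]; intros f h g Hf Hunif.
  - exists (g []); split; [now split|].
    apply (filterlim_C F); intros d; generalize (Hunif d); apply filter_imp.
    intros p Hp; destruct (Hf p) as [_ <-]; apply (Hp []); constructor.
  - set (G := fun Y1 => torus_int eps (fun Y => g (Y1 :: Y))).
    (* For a fixed outer variable the slices still converge uniformly, so the limit slice is
       integrable. *)
    assert (HG : forall Y1, Cmod Y1 = e ->
      is_torus_int eps (fun Y => g (Y1 :: Y)) (G Y1)).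
    { intros Y1 HY.
      destruct (IH (fun p Y => f p (Y1 :: Y))
        (fun p => torus_int eps (fun Y => f p (Y1 :: Y)))
        (fun Y => g (Y1 :: Y))) as [J [[HJ _] _]].
      - intros p; apply (is_torus_int_cons_inv _ _ _ _ (Hf p)); exact HY.
      - intros d; generalize (Hunif d); apply filter_imp.
        intros p Hp Y HYs; apply Hp; now constructor.
      - now split. }
    set (M := Rprod (map (fun e => 2 * PI * e)%R eps)).
    assert (HM : (0 <= M)%R).
    { apply Rlt_le, Rprod_pos, Forall_map; revert Heps; apply Forall_impl.
      intros a Ha; apply Rmult_lt_0_compat; [exact Rgt_2PI_0 | exact Ha]. }
    destruct (filterlim_RInt (V := C_R_CompleteNormedModule)
      (fun p => circle_integrand e (fun Y1 => torus_int eps (fun Y => f p (Y1 :: Y))))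
      0 (2 * PI) F FF (circle_integrand e G) h) as [I [HI1 HI2]].
    + intros p; apply (is_torus_int_cons_inv _ _ _ _ (Hf p)).
    + apply filterlim_locally; intros d.
      (* Inner integration costs a factor M and dY a factor e; the added 1 makes the resulting bound
         strictly less than d. *)
      assert (Hd : (0 < d / (M * e + 1))%R).
      { apply Rdiv_lt_0_compat; [apply cond_pos|].
        pose proof (Rmult_le_pos _ _ HM (Rlt_le _ _ He)); lra. }
      generalize (Hunif (mkposreal _ Hd)); apply filter_imp; simpl; intros p Hp t.
      apply (norm_compat1 (V := C_R_NormedModule)); rewrite <- Cmod_norm.
      set (c := circle e t).
      assert (HC : Cmod c = e) by (apply Cmod_circle; lra).
      set (P := torus_int eps (fun Y => f p (c :: Y))).
      assert (HB : (Cmod (P + - (1) * G c) <= M * (d / (M * e + 1)))%R).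
      { refine (is_torus_int_bound eps _ _ _ Heps (is_torus_int_lin eps (- (1)) _ _ _ _ Heps
          (proj1 (is_torus_int_cons_inv _ _ _ _ (Hf p)) c HC) (HG c HC)) _).
        intros Y HY; apply Rlt_le.
        replace (f p (c :: Y) + - (1) * g (c :: Y)) with (f p (c :: Y) - g (c :: Y))
          by ring.
        apply Hp; now constructor. }
      match goal with |- (Cmod ?a < _)%R =>
        replace a with ((P + - (1) * G c) * (Ci * c)) end.
      2: { unfold circle_integrand; fold c; fold P.
           change (@eq C ((P + - (1) * G c) * (Ci * c))
             (P * (Ci * c) - G c * (Ci * c))); ring. }
      rewrite !Cmod_mult, Cmod_Ci, HC, Rmult_1_l.
      pose proof (Rmult_le_pos _ _ HM (Rlt_le _ _ He)).
      apply Rle_lt_trans with (M * (d / (M * e + 1)) * e)%R;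
        [apply Rmult_le_compat_r; lra|].
      replace (M * (d / (M * e + 1)) * e)%R with (d - d / (M * e + 1))%R
        by (field; lra).
      lra.
    + exists I; split; [|exact HI1].
      exact (is_torus_int_cons _ _ _ _ _ He HG HI2).
Qed.

(** * Products over the torus variables and termwise integration *)

Lemma Rprod_map_1_plus_pos (l : list R) : List.Forall (fun e => (0 < e)%R) l ->
  (0 < Rprod (map (fun e => 1 + e) l))%R.
Proof.
  intros H; apply Rprod_pos, Forall_map; revert H; apply Forall_impl; intros; lra.
Qed.

Lemma pascal_coeff_prod_bound (eps : list R) (j k : nat) :
  List.Forall (fun e => (0 < e)%R) eps ->
  (pascal_coeff j k ^ length eps * Rprod eps ^ k
   <= Rprod (map (fun e => 1 + e)%R eps) ^ (j + k))%R.
Proof.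
  intros H; induction H as [|e eps He Heps IH]; unfold Rprod in *; simpl.
  - rewrite !pow1; lra.
  - rewrite !Rpow_mult_distr.
    replace (pascal_coeff j k * pascal_coeff j k ^ length eps
        * (e ^ k * fold_right Rmult 1 eps ^ k))%R
      with (pascal_coeff j k * e ^ k
        * (pascal_coeff j k ^ length eps * fold_right Rmult 1 eps ^ k))%R by ring.
    pose proof (Rprod_pos eps Heps) as HP.
    apply Rmult_le_compat; [| |apply pascal_coeff_bound; lra|exact IH];
      apply Rmult_le_pos; repeat apply pow_le;
      try apply Rlt_le, pascal_coeff_pos; try exact (Rlt_le _ _ HP); lra.
Qed.

Lemma on_torus_Cmod_Cprod (eps : list R) (Y : list C) :
  on_torus eps Y -> Cmod (Cprod Y) = Rprod eps.
Proof.
  unfold Cprod, Rprod; induction 1 as [|Y1 e Y eps H _ IH]; simpl.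
  - apply Cmod_1.
  - now rewrite Cmod_mult, IH, H.
Qed.

Lemma on_torus_Cmod_Cprod_1_plus (eps : list R) (Y : list C) :
  on_torus eps Y ->
  (Cmod (Cprod (map (fun Yj => 1 + Yj)%C Y)) <= Rprod (map (fun e => 1 + e)%R eps))%R.
Proof.
  unfold Cprod, Rprod; induction 1 as [|Y1 e Y eps H _ IH]; simpl.
  - rewrite Cmod_1; lra.
  - rewrite Cmod_mult; apply Rmult_le_compat; [apply Cmod_ge_0..| |exact IH].
    eapply Rle_trans; [apply Cmod_triangle|]; rewrite Cmod_1, H; lra.
Qed.

Lemma Cprod_map_Cinv (Y : list C) :
  Cprod Y <> 0 -> Cprod (map Cinv Y) = / Cprod Y.
Proof.
  unfold Cprod; induction Y as [|Y1 Y IH]; simpl; intros H.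
  - field; exact C1_nz.
  - assert (H1 : Y1 <> 0) by (intros ->; apply H; ring).
    assert (H2 : fold_right Cmult 1 Y <> 0) by (intros E; apply H; rewrite E; ring).
    rewrite IH by exact H2; field; auto.
Qed.

Lemma Cprod_map_monomial (Y : list C) (n k : nat) :
  Cprod (map (fun Yj => (1 + Yj) ^ n * (/ Yj) ^ k * / Yj) Y)
  = Cprod (map (fun Yj => 1 + Yj) Y) ^ n * Cprod (map Cinv Y) ^ k
    * Cprod (map Cinv Y).
Proof.
  unfold Cprod; induction Y as [|Y1 Y IH]; simpl.
  - rewrite !Cpow_1_l; ring.
  - rewrite IH, !Cpow_mult_l; ring.
Qed.

(** Since dY = i Y dt, the factor 1/Y cancels and [is_RInt_binomial] remains, multiplied by i. *)
Lemma is_RInt_monomial (e : R) (j k : nat) : (0 < e)%R ->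
  is_RInt_C (circle_integrand e
    (fun Y => (1 + Y) ^ (j + k) * (/ Y) ^ k * / Y)) 0 (2 * PI)
    (2 * PI * Ci * pascal_coeff j k).
Proof.
  intros He.
  refine (is_RInt_C_ext _ _ _ _ _ _ _ _
    (is_RInt_C_mult_l Ci _ _ _ _ (is_RInt_binomial e j k He))).
  - intros t; pose proof (circle_neq_0 e t He) as Hc; unfold circle_integrand.
    rewrite Cpow_inv by exact Hc; field.
    split; [exact Hc | now apply Cpow_nz].
  - rewrite !RtoC_mult; ring.
Qed.

Lemma K_term_eq (N : nat) (x y z : C) (j k : nat) : z <> 0 ->
  K_term N x y z j k
  = RtoC (pascal_coeff j k) ^ N * ((x / z) ^ j * (y / z) ^ k).
Proof.
  intros Hz; unfold K_term; fold (pascal_coeff j k); f_equal.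
  unfold Cdiv; rewrite !Cpow_mult_l, !Cpow_inv, Cpow_add_r by exact Hz.
  field; split; now apply Cpow_nz.
Qed.

(** Each term already carries one binomial coefficient from the expansion of 1/(1 - u - v), and
    every circle contributes another; hence the exponent [S (length eps)]. *)
Lemma is_torus_int_pascal_rect (eps : list R) (a b : C) (m n : nat) :
  List.Forall (fun e => (0 < e)%R) eps ->
  is_torus_int eps
    (fun Y => pascal_rect (Cprod (map (fun Yj => 1 + Yj) Y) * a)
       (Cprod (map (fun Yj => 1 + Yj) Y) * (b / Cprod Y)) m n
       * Cprod (map Cinv Y))
    ((2 * PI * Ci) ^ length eps
     * sum_n (fun j => sum_n (fun k =>
         RtoC (pascal_coeff j k) ^ S (length eps) * (a ^ j * b ^ k)) n) m).
Proof.
  intros Heps.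
  set (t := fun j k Y => RtoC (pascal_coeff j k) * (a ^ j * b ^ k)
    * Cprod (map (fun Yj => (1 + Yj) ^ (j + k) * (/ Yj) ^ k * / Yj) Y)).
  set (I := fun j k => RtoC (pascal_coeff j k) * (a ^ j * b ^ k)
    * (2 * PI * Ci * pascal_coeff j k) ^ length eps).
  assert (H : is_torus_int eps
    (fun Y => sum_n (fun j => sum_n (fun k => t j k Y) n) m)
    (sum_n (fun j => sum_n (fun k => I j k) n) m)).
  { apply (is_torus_int_sum_n eps _ _ m Heps); intros j.
    apply (is_torus_int_sum_n eps _ _ n Heps); intros k.
    apply is_torus_int_prod; revert Heps; apply Forall_impl.
    intros e He; split; [exact He | now apply is_RInt_monomial]. }
  rewrite <- sum_n_Cmult_l.
  rewrite (sum_n_ext _ (fun j => sum_n (fun k => I j k) n)).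
  - refine (is_torus_int_ext _ _ _ _ Heps _ H); intros Y HY.
    assert (HnzY : Cprod Y <> 0).
    { apply Cmod_gt_0; rewrite (on_torus_Cmod_Cprod _ _ HY); now apply Rprod_pos. }
    unfold pascal_rect; rewrite Cmult_comm, <- sum_n_Cmult_l.
    apply sum_n_ext; intros j; rewrite <- sum_n_Cmult_l.
    apply sum_n_ext; intros k; unfold t.
    rewrite Cprod_map_monomial, Cpow_add_r; unfold Cdiv.
    rewrite (Cprod_map_Cinv Y HnzY), !Cpow_mult_l; ring_C.
  - intros j; rewrite <- sum_n_Cmult_l; apply sum_n_ext; intros k; unfold I.
    rewrite (Cpow_mult_l (2 * PI * Ci)); simpl; ring_C.
Qed.

Lemma eventually_pow_lt (r d : R) : (0 <= r < 1)%R -> (0 < d)%R ->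
  eventually (fun n => (r ^ S n < d)%R).
Proof.
  intros Hr Hd.
  destruct (pow_lt_1_zero r) with (y := d) as [n0 Hn0]; [|exact Hd|].
  - rewrite Rabs_pos_eq; lra.
  - exists n0; intros n Hn; specialize (Hn0 (S n) ltac:(lia)).
    rewrite Rabs_pos_eq in Hn0; [exact Hn0 | apply pow_le; lra].
Qed.

Lemma double_series_unique (a : nat -> nat -> C) (s : C) :
  is_double_series a s -> double_series a = s.
Proof.
  intros H; unfold double_series.
  apply (iota_unique (V := C_R_CompleteNormedModule)); [|exact H].
  intros s' [_ H']; destruct H as [_ H].
  exact (filterlim_locally_unique (V := C_R_NormedModule) _ _ _ H' H).
Qed.

(** Only absolute convergence is left to prove. By [pascal_coeff_prod_bound] the terms are dominated
    by those of the double binomial series at the two summands of the smallness hypothesis. *)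
Lemma is_double_series_K_term (N : nat) (x y z s : C) (eps : list R) :
  length eps = N -> List.Forall (fun e => (0 < e)%R) eps -> z <> 0 ->
  (Rprod (map (fun e => 1 + e)%R eps) * Cmod (x / z)
   + Rprod (map (fun e => 1 + e)%R eps) * (Cmod (y / z) / Rprod eps) < 1)%R ->
  filterlim (fun p : nat * nat =>
      sum_n (fun j => sum_n (K_term (S N) x y z j) (snd p)) (fst p))
    (filter_prod eventually eventually) (locally s) ->
  is_double_series (K_term (S N) x y z) s.
Proof.
  intros <- Heps Hz Huv Hlim; split; [|exact Hlim].
  pose proof (Rprod_pos _ Heps) as HE.
  pose proof (Rprod_map_1_plus_pos _ Heps) as HP.
  set (P := Rprod (map (fun e => 1 + e)%R eps)) in *.
  set (E := Rprod eps) in *.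
  pose proof (Cmod_ge_0 (x / z)) as HA; pose proof (Cmod_ge_0 (y / z)) as HB.
  set (A := Cmod (x / z)) in *; set (B := Cmod (y / z)) in *.
  assert (HBE : (0 <= B / E)%R)
    by (apply Rmult_le_pos; [exact HB | apply Rlt_le, Rinv_0_lt_compat, HE]).
  eexists; intros m n.
  eapply Rle_trans; [|apply (pascal_rect_R_bound (P * A) (P * (B / E)) m n);
    [apply Rmult_le_pos; lra | apply Rmult_le_pos; lra | exact Huv]].
  apply sum_n_Rle; intros j; apply sum_n_Rle; intros k.
  pose proof (pascal_coeff_pos j k) as Hc.
  pose proof (pascal_coeff_prod_bound eps j k Heps) as Hb; fold P E in Hb.
  rewrite K_term_eq, !Cmod_mult, !Cmod_pow, Cmod_R, Rabs_pos_eq by (auto; lra).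
  fold A B; rewrite !Rpow_mult_distr; unfold Rdiv; rewrite Rpow_mult_distr.
  assert (HEk : (0 < E ^ k)%R) by now apply pow_lt.
  assert (HAB : (0 <= A ^ j * B ^ k)%R) by (apply Rmult_le_pos; now apply pow_le).
  replace (pascal_coeff j k * (P ^ j * A ^ j * (P ^ k * (B ^ k * (/ E) ^ k))))%R
    with (pascal_coeff j k * (P ^ (j + k) * (/ E) ^ k) * (A ^ j * B ^ k))%R
    by (rewrite pow_add; ring).
  apply Rmult_le_compat_r; [exact HAB|]; simpl pow.
  apply Rmult_le_compat_l; [lra|].
  apply Rmult_le_reg_r with (E ^ k)%R; [exact HEk|].
  rewrite pow_inv, Rmult_assoc, Rinv_l by lra.
  now rewrite Rmult_1_r.
Qed.

(* The hypothesis [Hxyz] says exactly that (x/z, y/z) lies in the largest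
   complete Reinhardt neighbourhood of the origin on which
   W(x/z, y/z, 1) has no zero on the torus T, i.e. where 1/W expands as a
   geometric series on T; it forces z <> 0. *)
Theorem theorem2p1 (N : nat) (HN : (2 <= N)%nat)
  (eps : list R) (Hlen : length eps = (N - 1)%nat)
  (Heps : List.Forall (fun e => (0 < e)%R) eps)
  (x y z : C)
  (Hxyz : (Rprod (map (fun e => 1 + e) eps) * (Cmod x + Cmod y / Rprod eps)
           < Cmod z)%R) :
  ex_double_series (K_term N x y z) /\
  (forall Y : list C, on_torus eps Y -> W (x / z) (y / z) 1 Y <> 0) /\
  ex_torus_int eps (K_integrand x y z) /\
  K N x y z
    = / (2 * PI * Ci) ^ (N - 1) * torus_int eps (K_integrand x y z).
Proof.
  assert (HN' : N = S (length eps)) by lia.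
  clear HN Hlen; subst N.
  replace (S (length eps) - 1)%nat with (length eps) by lia.
  pose proof (Rprod_pos _ Heps) as HE.
  pose proof (Rprod_map_1_plus_pos _ Heps) as HP.
  assert (HiE : (0 < / Rprod eps)%R) by now apply Rinv_0_lt_compat.
  assert (Hz0 : (0 < Cmod z)%R).
  { eapply Rle_lt_trans; [|exact Hxyz].
    pose proof (Cmod_ge_0 x).
    pose proof (Rmult_le_pos _ _ (Cmod_ge_0 y) (Rlt_le _ _ HiE)).
    apply Rmult_le_pos; unfold Rdiv; lra. }
  assert (Hz : z <> 0) by now apply Cmod_gt_0.
  set (U := (Rprod (map (fun e => 1 + e)%R eps) * Cmod (x / z))%R).
  set (V := (Rprod (map (fun e => 1 + e)%R eps) * (Cmod (y / z) / Rprod eps))%R).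
  assert (HU : (0 <= U)%R) by (apply Rmult_le_pos; [lra | apply Cmod_ge_0]).
  assert (HV : (0 <= V)%R).
  { apply Rmult_le_pos; [lra|]; apply Rmult_le_pos; [apply Cmod_ge_0 | lra]. }
  (* This is [Hxyz] divided by |z|. *)
  assert (HUV : (U + V < 1)%R).
  { unfold U, V; rewrite !Cmod_div by exact Hz.
    apply Rmult_lt_reg_r with (Cmod z); [exact Hz0|]; rewrite Rmult_1_l.
    eapply Rle_lt_trans; [right | exact Hxyz]; field; lra. }
  set (u := fun Y => Cprod (map (fun Yj => 1 + Yj) Y) * (x / z)).
  set (v := fun Y => Cprod (map (fun Yj => 1 + Yj) Y) * (y / z / Cprod Y)).
  assert (HW : forall Y, W (x / z) (y / z) 1 Y = 1 - (u Y + v Y))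
    by (intros Y; unfold W, u, v; ring).
  assert (HnzY : forall Y, on_torus eps Y -> Cprod Y <> 0).
  { intros Y HY; apply Cmod_gt_0; now rewrite (on_torus_Cmod_Cprod _ _ HY). }
  assert (Hu : forall Y, on_torus eps Y -> (Cmod (u Y) <= U)%R).
  { intros Y HY; unfold u, U; rewrite Cmod_mult.
    apply Rmult_le_compat_r; [apply Cmod_ge_0|].
    now apply on_torus_Cmod_Cprod_1_plus. }
  assert (Hv : forall Y, on_torus eps Y -> (Cmod (v Y) <= V)%R).
  { intros Y HY; unfold v, V.
    rewrite Cmod_mult, (Cmod_div (y / z)), (on_torus_Cmod_Cprod _ _ HY) by auto.
    apply Rmult_le_compat_r; [apply Rmult_le_pos; [apply Cmod_ge_0 | lra]|].
    now apply on_torus_Cmod_Cprod_1_plus. }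
  set (c := (2 * PI * Ci) ^ length eps).
  assert (Hc : c <> 0).
  { apply Cpow_nz; repeat apply Cmult_neq_0.
    - intros H; apply RtoC_inj in H; lra.
    - intros H; apply RtoC_inj in H; pose proof PI_RGT_0; lra.
    - exact Ci_nz. }
  set (rect := fun p : nat * nat =>
    sum_n (fun j => sum_n (K_term (S (length eps)) x y z j) (snd p)) (fst p)).
  (* The integrals of the partial sums are [c] times the kernel's partial sums, so their limit I
     links the kernel to the torus integral. *)
  destruct (is_torus_int_uniform_limit (filter_prod eventually eventually) eps
    (fun p Y => pascal_rect (u Y) (v Y) (fst p) (snd p) * Cprod (map Cinv Y))
    (fun p => c * rect p) (K_integrand x y z) Heps) as [I [[Hex HI] Hlim]].
  - intros [m n]; unfold rect; simpl fst; simpl snd.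
    rewrite (sum_n_ext _ (fun j => sum_n (fun k =>
      RtoC (pascal_coeff j k) ^ S (length eps)
      * ((x / z) ^ j * (y / z) ^ k)) n)).
    + exact (is_torus_int_pascal_rect eps (x / z) (y / z) m n Heps).
    + intros j; apply sum_n_ext; intros k; now apply K_term_eq.
  - intros d.
    (* Chosen so that two boundary terms below d', divided by 1 - (U + V) and by the modulus of the
       product of the Y_j, add up to d. *)
    set (d' := (d * Rprod eps * (1 - (U + V)) / 2)%R).
    assert (Hd' : (0 < d')%R).
    { unfold d', Rdiv; pose proof (cond_pos d).
      repeat apply Rmult_lt_0_compat; lra. }
    assert (Hratio : forall a b, (0 <= a -> 0 <= b -> a + b < 1 ->
      0 <= a * / (1 - b) < 1)%R).
    { intros a b Ha Hb Hab.
      assert (0 < / (1 - b))%R by (apply Rinv_0_lt_compat; lra).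
      split; [apply Rmult_le_pos; lra|].
      apply Rmult_lt_reg_r with (1 - b)%R; [lra|].
      rewrite Rmult_assoc, Rinv_l; lra. }
    refine (Filter_prod _ _ _ _ _
      (eventually_pow_lt (U * / (1 - V)) d' (Hratio _ _ HU HV HUV) Hd')
      (eventually_pow_lt (V * / (1 - U)) d' (Hratio _ _ HV HU ltac:(lra)) Hd') _).
    intros m n Hm Hn Y HY; simpl fst; simpl snd.
    unfold K_integrand; rewrite HW.
    replace (pascal_rect (u Y) (v Y) m n * Cprod (map Cinv Y)
        - / (1 - (u Y + v Y)) * Cprod (map Cinv Y))
      with ((pascal_rect (u Y) (v Y) m n - / (1 - (u Y + v Y)))
        * Cprod (map Cinv Y)) by ring.
    rewrite Cprod_map_Cinv, Cmod_mult, Cmod_inv, (on_torus_Cmod_Cprod _ _ HY)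
      by auto.
    assert (Hi : (0 < / (1 - (U + V)))%R) by (apply Rinv_0_lt_compat; lra).
    eapply Rle_lt_trans.
    { apply Rmult_le_compat_r; [lra|].
      exact (Cmod_pascal_rect_sub _ _ U V m n (Hu Y HY) (Hv Y HY) HUV). }
    apply Rlt_le_trans with ((d' + d') * / (1 - (U + V)) * / Rprod eps)%R.
    + repeat apply Rmult_lt_compat_r; lra.
    + right; unfold d'; field; lra.
  - assert (HS : is_double_series (K_term (S (length eps)) x y z) (/ c * I)).
    { apply (is_double_series_K_term _ x y z _ eps eq_refl Heps Hz HUV); fold rect.
      apply (filterlim_C (filter_prod eventually eventually)); intros d.
      assert (Hc0 : (0 < Cmod c)%R) by now apply Cmod_gt_0.
      assert (Hd : (0 < d * Cmod c)%R)
        by (apply Rmult_lt_0_compat; [apply cond_pos | exact Hc0]).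
      generalize (proj1 (filterlim_locally_ball_norm (U := C_R_NormedModule) _ _)
        Hlim (mkposreal _ Hd)).
      apply filter_imp; unfold ball_norm; simpl; intros p Hp.
      rewrite <- Cmod_norm in Hp.
      replace (rect p - / c * I) with (/ c * (c * rect p - I)) by (field; exact Hc).
      rewrite Cmod_mult, Cmod_inv by exact Hc.
      apply Rmult_lt_reg_l with (Cmod c); [exact Hc0|].
      rewrite <- Rmult_assoc, Rinv_r, Rmult_1_l, (Rmult_comm (Cmod c)) by lra.
      exact Hp. }
    split; [now exists (/ c * I)|]; split; [|split; [exact Hex|]].
    (* A zero of W would force u + v = 1, against |u| + |v| <= U + V < 1. *)
    + intros Y HY HW0; rewrite HW in HW0.
      assert (H1 : u Y + v Y = 1) by (symmetry; now apply Ceq_minus).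
      pose proof (Cmod_triangle (u Y) (v Y)) as HT; rewrite H1, Cmod_1 in HT.
      specialize (Hu Y HY); specialize (Hv Y HY); lra.
    + rewrite HI; exact (double_series_unique _ _ HS).
Qed.
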